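(* Let $n,d\ge1$ be integers. There exist a constant $c_{n,d}>0$, depending only on $n$ and $d$, and $r_0\in\mathbb N$ with $r_0\ge d$ such that for every $p\in R_{2d}$, $$p_{\min}-\mathrm{sp}_r(p)\le(p_{\max}-p_{\min})\cdot\frac{c_{n,d}}{r}\qquad\text{for all integers } r\ge r_0.$$
   Context: $R_{2d}$ is the space of real homogeneous polynomials of degree $2d$ in $x=(x_1,\dots,x_n)$; $s=x_1^2+\cdots+x_n^2$; $p_{\min}$ and $p_{\max}$ are the minimum and maximum of $p$ on the unit sphere $\{x\in\mathbb R^n:\|x\|_2=1\}$. Let $[n]=\{1,\dots,n\}$. A matrix $A\in\mathbb R^{[n]^d\times[n]^d}$ is maximally symmetric if, viewed as a $2d$-tensor with entries $A_{\underline i,\underline j}$ at position $\underline i\,\underline j\in[n]^{2d}$, it is invariant under all permutations of the $2d$ indices. Every $f\in R_{2d}$ has a unique maximally symmetric matrix $\mathrm{MaxSym}(f)\in\mathbb R^{[n]^d\times[n]^d}$ with $f(x)=\langle\mathrm{MaxSym}(f),(xx^T)^{\otimes d}\rangle$ (trace inner product). Set $Q(p)=\mathrm{MaxSym}(p)$ and $M=\mathrm{MaxSym}(s^d)$. Let $\Pi_r$ be the orthogonal projection of $(\mathbb R^n)^{\otimes r}$ onto the subspace $S^r(\mathbb R^n)$ of symmetric $r$-tensors. For $r\ge d$ set $Q_r(p)=\Pi_r(Q(p)\otimes I_n^{\otimes(r-d)})\Pi_r$ and $M_r=\Pi_r(M\otimes I_n^{\otimes(r-d)})\Pi_r$. The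 spectral bound is $\mathrm{sp}_r(p)=\max\{\nu\in\mathbb R: Q_r(p)-\nu M_r\succeq0\}=\min\{v^TQ_r(p)v: v\in S^r(\mathbb R^n),\,v^TM_rv=1\}$. *)

(* Defs.v *)
From mathcomp Require Import all_boot all_order all_algebra.
From mathcomp Require Import fingroup perm.
From mathcomp Require Import boolp classical_sets reals.
From mathcomp Require Import mpoly.

Set Implicit Arguments.
Unset Strict Implicit.
Unset Printing Implicit Defensive.

Import Order.TTheory GRing.Theory Num.Theory.
Local Open Scope ring_scope.
Local Open Scope classical_set_scope.

(* (R^n)^{\otimes r} is 'rV[R]_(tdim n r): coordinates are indexed by [n]^r,
   i.e. by r.-tuple 'I_n, through enum_rank / enum_val. *)
Definition tdim (n r : nat) : nat := #|{: r.-tuple 'I_n}|.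

Definition tmx (R : realType) (n r : nat)
    (F : r.-tuple 'I_n -> r.-tuple 'I_n -> R) : 'M[R]_(tdim n r) :=
  \matrix_(a, b) F (enum_val a) (enum_val b).

Definition tentry (R : realType) (n r : nat) (A : 'M[R]_(tdim n r))
    (t u : r.-tuple 'I_n) : R :=
  A (enum_rank t) (enum_rank u).

Definition tleft (n a b : nat) (t : (a + b).-tuple 'I_n) : a.-tuple 'I_n :=
  [tuple tnth t (lshift b i) | i < a].

Definition tright (n a b : nat) (t : (a + b).-tuple 'I_n) : b.-tuple 'I_n :=
  [tuple tnth t (rshift a i) | i < b].

Definition tact (n r : nat) (s : 'S_r) (t : r.-tuple 'I_n) : r.-tuple 'I_n :=
  [tuple tnth t (s i) | i < r].

Definition tens (R : realType) (n a b : nat)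
    (A : 'M[R]_(tdim n a)) (B : 'M[R]_(tdim n b)) : 'M[R]_(tdim n (a + b)) :=
  tmx (fun t u => tentry A (tleft t) (tleft u) * tentry B (tright t) (tright u)).

(* X^{\otimes r} *)
Definition tpow (R : realType) (n : nat) (X : 'M[R]_n) (r : nat) :
    'M[R]_(tdim n r) :=
  tmx (fun t u => \prod_(i < r) X (tnth t i) (tnth u i)).

Definition tperm_mx (R : realType) (n r : nat) (s : 'S_r) : 'M[R]_(tdim n r) :=
  tmx (fun t u => (t == tact s u)%:R).

(* S^r(R^n), as a row space: the tensors fixed by all index permutations *)
Definition symT (R : realType) (n r : nat) : 'M[R]_(tdim n r) :=
  (\bigcap_(s : 'S_r) eigenspace (tperm_mx R n s) 1)%MS.

Lemma symTP (R : realType) (n r : nat) (v : 'rV[R]_(tdim n r)) :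
  reflect (forall (s : 'S_r) (t : r.-tuple 'I_n),
             v 0 (enum_rank (tact s t)) = v 0 (enum_rank t))
          (v <= symT R n r)%MS.
Proof.
have E s : v *m tperm_mx R n s = \row_b v 0 (enum_rank (tact s (enum_val b))).
  apply/rowP => b; rewrite !mxE (bigD1 (enum_rank (tact s (enum_val b)))) //=.
  rewrite big1 ?addr0; first by rewrite mxE enum_rankK eqxx mulr1.
  move=> a ne; rewrite mxE; case: eqP => [e|]; last by rewrite mulr0.
  by case/eqP: ne; rewrite -e enum_valK.
apply: (iffP sub_bigcapmxP) => [h s t|h s _].
  have /eigenspaceP := h s isT; rewrite E scale1r => /rowP/(_ (enum_rank t)).
  by rewrite mxE enum_rankK.
apply/eigenspaceP; rewrite E scale1r; apply/rowP => b.
by rewrite mxE h enum_valK.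
Qed.

(* orthogonal projection onto the row space of U; acts on row vectors *)
Definition orthoproj (R : realType) (m N : nat) (U : 'M[R]_(m, N)) : 'M[R]_N :=
  proj_mx <<U>>%MS (kermx U^T).

(* Pi_r *)
Definition symproj (R : realType) (n r : nat) : 'M[R]_(tdim n r) :=
  orthoproj (symT R n r).

Definition psdmx (R : realType) (N : nat) (A : 'M[R]_N) : Prop :=
  A^T = A /\ forall v : 'rV[R]_N, 0 <= (v *m A *m v^T) 0 0.

Definition peval (R : realType) (n : nat) (p : {mpoly R[n]}) (x : 'cV[R]_n) : R :=
  p.@[fun i => x i 0].

Definition usphere (R : realType) (n : nat) : set 'cV[R]_n :=
  [set x | Num.sqrt (\sum_(i < n) x i 0 ^+ 2) = 1].
Arguments usphere : clear implicits.

(* For 1 <= n the sphere is nonempty and compact, so the inf and the sup below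
   are attained. *)
Definition pmin (R : realType) (n : nat) (p : {mpoly R[n]}) : R :=
  inf [set peval p x | x in usphere R n].

Definition pmax (R : realType) (n : nat) (p : {mpoly R[n]}) : R :=
  sup [set peval p x | x in usphere R n].

Definition sqnorm (R : realType) (n : nat) : {mpoly R[n]} :=
  \sum_(i < n) 'X_i ^+ 2.

Definition maxsym (R : realType) (n d : nat) (A : 'M[R]_(tdim n d)) : Prop :=
  forall (s : 'S_(d + d)) (t : (d + d).-tuple 'I_n),
    tentry A (tleft (tact s t)) (tright (tact s t))
    = tentry A (tleft t) (tright t).

Definition is_MaxSym (R : realType) (n d : nat) (f : {mpoly R[n]})
    (A : 'M[R]_(tdim n d)) : Prop :=
  maxsym A /\
  forall x : 'cV[R]_n, peval f x = \tr (A^T *m tpow (x *m x^T) d).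

(* the default 0 is used only when f is not homogeneous of degree 2d *)
Definition MaxSym (R : realType) (n d : nat) (f : {mpoly R[n]}) :
    'M[R]_(tdim n d) :=
  xget 0 [set A | is_MaxSym f A].

(* Pi_r (A \otimes I_n^{\otimes (r-d)}) Pi_r.  The order d + (r - d) is r when
   d <= r; it is left unreduced to avoid a cast. *)
Definition symlift (R : realType) (n d r : nat) (A : 'M[R]_(tdim n d)) :
    'M[R]_(tdim n (d + (r - d))) :=
  symproj R n (d + (r - d)) *m tens A (tpow 1%:M (r - d))
    *m symproj R n (d + (r - d)).

Definition Qr (R : realType) (n d r : nat) (p : {mpoly R[n]}) :
    'M[R]_(tdim n (d + (r - d))) :=
  symlift r (MaxSym d p).

Definition Mr (R : realType) (n d r : nat) : 'M[R]_(tdim n (d + (r - d))) :=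
  symlift r (MaxSym d (sqnorm R n ^+ d)).

(* For 1 <= n and 1 <= d <= r this set is nonempty, closed and bounded above
   (Mr is positive definite on S^r), so the sup is a maximum. *)
Definition sp (R : realType) (n d r : nat) (p : {mpoly R[n]}) : R :=
  sup [set nu : R | psdmx (Qr d r p - nu *: Mr R n d r)].

(* Main.v *)
From HB Require Import structures.
Require Import Defs.
From mathcomp Require Import all_boot all_order all_algebra.
From mathcomp Require Import fingroup perm.
From mathcomp Require Import boolp classical_sets reals.
From mathcomp Require Import complex.
From mathcomp Require Import ssrcomplements mpoly.
From mathcomp Require Import ring lra zify.

(** Write s for the squared norm and F_A(v) for the quadratic form of
    A (x) I on symmetric r-tensors v.  Subtracting p_min s^d from p reduces the
    theorem to the following: if a form q of degree 2d satisfies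
    0 <= q <= K s^d pointwise and A is its symmetric tensor, then
    F_A(v) >= - (K c / r) F_M(v), where M is the symmetric tensor of s^d.

    The proof tests q against a squared Hermite polynomial.  Let E be the
    expectation under the standard Gaussian measure of R^n, and let h_v be the
    Hermite polynomial obtained by evaluating the tensor v on the commuting
    creation operators X_i - d_i and applying the result to 1.  Creation
    operators are adjoint to derivations, so integrating by parts r times and
    using the Leibniz rule gives ([gauss_hermite_sqr])

      E[q h_v^2] = sum_k C(r,k) (r!/k!) sum_(a,c in [n]^k) E[d_a d_c q]
                                          sum_(b in [n]^(r-k)) v_ab v_cb.

    For k > d the derivatives vanish.  For k = d they are the constants
    (2d)! A_ac, so this term is a positive multiple of F_A(v).  For k < d the
    weights are smaller than the one at k = d by a factor O(1/r)
    ([hermite_weight_le]), while E[d_w q] = E[q h_w] is O(K) since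
    0 <= q <= K s^d ([gauss_pderivs_le]).  The left-hand side is nonnegative
    because q is, whence F_A(v) >= - C K |v|^2 / r ([qform_ge]).

    It remains to bound |v|^2 by F_M(v).  By rotation invariance M is, up to a
    positive factor, the Gaussian moment tensor E[X^(2d)], so F_M(v) is a sum of
    Gaussian second moments of forms of degree d.  Projecting such a form onto
    its own Hermite polynomial bounds that second moment below by the squared
    norm of its tensor ([qform_sqnorm_ge]).

    The measure itself is replaced by the linear functional [gauss], given on
    monomials by the Gaussian moments.  The argument uses two of its properties:
    integration by parts, which is the recursion between moments, and positivity
    on polynomials that are nonnegative at every point ([gauss_ge0]).
    Integrating out one coordinate at a time reduces positivity to one variable.
    There a positive polynomial is a product of positive quadratics, hence a sum
    of squares, and the moment functional is nonnegative on squares by the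
    Parseval identity E[w^2] = sum_k (E[w^(k)])^2 / k!. *)

Set Implicit Arguments.
Unset Strict Implicit.
Unset Printing Implicit Defensive.

Import Order.TTheory GRing.Theory Num.Theory.
Local Open Scope ring_scope.

(** * One-dimensional Gaussian moments *)
Fixpoint gmoment (R : realType) (k : nat) : R :=
  match k with
  | 0 => 1
  | 1 => 0
  | (j.+1 as k').+1 => k'%:R * gmoment R j
  end.

Definition gauss1 (R : realType) (p : {poly R}) : R :=
  \sum_(i < size p) p`_i * gmoment R i.

Lemma gauss1_widen (R : realType) (p : {poly R}) (k : nat) :
  (size p <= k)%N -> gauss1 p = \sum_(i < k) p`_i * gmoment R i.
Proof.
move=> hk; rewrite /gauss1 (big_ord_widen k (fun i => p`_i * gmoment R i)) //.
rewrite big_mkcond /=; apply: eq_bigr => i _; case: ltnP => // hi.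
by rewrite nth_default // mul0r.
Qed.

Lemma gauss1_is_linear (R : realType) :
  linear_for *%R (@gauss1 R).
Proof.
move=> a p q.
have hle : (size (a *: p + q)%R <= maxn (size p) (size q))%N.
  apply: leq_trans (size_polyD _ _) _.
  by rewrite geq_max !leq_max size_scale_leq leqnn orbT.
rewrite (gauss1_widen hle) (gauss1_widen (leq_maxl (size p) (size q))).
rewrite (gauss1_widen (leq_maxr (size p) (size q))) mulr_sumr -big_split /=.
by apply: eq_bigr => i _; rewrite coefD coefZ mulrDl mulrA.
Qed.

HB.instance Definition _ (R : realType) :=
  GRing.isLinear.Build R {poly R} R *%R (@gauss1 R) (@gauss1_is_linear R).

Lemma gauss1D (R : realType) : {morph @gauss1 R : p q / p + q}.
Proof. exact: raddfD. Qed.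

Lemma gauss1Z (R : realType) (c : R) (p : {poly R}) :
  gauss1 (c *: p) = c * gauss1 p.
Proof. exact: linearZ. Qed.

Lemma gauss1_0 (R : realType) : gauss1 0 = 0 :> R.
Proof. exact: raddf0. Qed.

Lemma gauss1C (R : realType) (c : R) : gauss1 c%:P = c.
Proof. by rewrite (@gauss1_widen _ _ 1) ?size_polyC_leq1 // big_ord1 coefC mulr1. Qed.

Lemma gauss1X (R : realType) (p : {poly R}) : gauss1 ('X * p) = gauss1 p^`().
Proof.
rewrite (@gauss1_widen _ _ (size p).+1); last first.
  by rewrite mulrC; apply: leq_trans (size_polyMleq _ _) _; rewrite size_polyX addn2.
rewrite (@gauss1_widen _ p^`() (size p).-1); last exact: size_poly.
rewrite big_ord_recl coefXM mul0r add0r.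
case: (size p) => [|s] /=; first by rewrite !big_ord0.
rewrite big_ord_recl coefXM /= mulr0 add0r.
apply: eq_bigr => i _; rewrite coefXM coef_deriv /=.
by rewrite mulrA mulr_natr.
Qed.

(** The numbers [gauss1 f^`(k)] / sqrt k! are the coordinates of f in the
    orthonormal basis of Hermite polynomials.  The proof is by induction on the
    degree of f: multiplication by 'X is traded for a derivative by [gauss1X],
    on both sides. *)
Lemma gauss1_parseval (R : realType) (N : nat) (f g : {poly R}) :
  (size g <= N)%N ->
  gauss1 (f * g) = \sum_(k < N) gauss1 f^`(k) * gauss1 g^`(k) / k`!%:R.
Proof.
pose B m p q : R := \sum_(k < m) gauss1 p^`(k) * gauss1 q^`(k) / k`!%:R.
have BD m p1 p2 q : B m (p1 + p2) q = B m p1 q + B m p2 q.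
  by rewrite -big_split /=; apply: eq_bigr => k _; rewrite derivnD gauss1D !mulrDl.
have [m] := ubnP (size f); elim: m f g N => // m IH f g N.
elim/poly_ind: f => [|f c _] hf hg.
  rewrite mul0r gauss1_0 big1 // => k _.
  by rewrite [_^`(k)]raddf0 gauss1_0 !mul0r.
rewrite mulrDl gauss1D -/(B N _ g) BD; congr (_ + _); last first.
  case: N hg => [|N] hg.
    move: hg; rewrite leqn0 size_poly_eq0 => /eqP->.
    by rewrite mulr0 gauss1_0 /B big_ord0.
  rewrite /B big_ord_recl !derivn0 gauss1C divr1 big1 ?addr0.
    by rewrite mul_polyC gauss1Z.
  by move=> k _; rewrite lift0 derivnC /= gauss1_0 !mul0r.
have [->|f0] := eqVneq f 0.
  rewrite !mul0r gauss1_0 /B big1 // => k _.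
  by rewrite [_^`(k)]raddf0 gauss1_0 !mul0r.
have hf1 : (size f < m)%N by move: hf; rewrite size_MXaddC (negPf f0).
rewrite /= mulrAC [f * g * _]mulrC.
rewrite gauss1X derivM gauss1D (IH f^`() g N) //; last first.
  by apply: leq_ltn_trans hf1; apply: leq_trans (size_poly _ _) (leq_pred _).
rewrite (IH f g^`() N.-1) //; last first.
  by apply: leq_trans (size_poly _ _) _; rewrite -!subn1 leq_sub2r.
have E k : gauss1 (f * 'X)^`(k) = gauss1 f^`(k.+1) + k%:R * gauss1 f^`(k.-1).
  have -> : (f * 'X)^`(k) = 'X * f^`(k) + f^`(k.-1) *+ k.
    elim: k => [|k IHk]; first by rewrite !derivn0 mulr0n addr0 mulrC.
    rewrite derivnS IHk derivD derivM derivX mul1r derivMn -!derivnS.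
    case: k {IHk} => [|k]; first by rewrite /= !mulr0n addr0 addrC.
    by rewrite /=; ring.
  by rewrite gauss1D gauss1X raddfMn /= -derivnS mulr_natl.
have -> : B N (f * 'X) g = \sum_(k < N) gauss1 f^`(k.+1) * gauss1 g^`(k) / k`!%:R
   + \sum_(k < N) k%:R * gauss1 f^`(k.-1) * gauss1 g^`(k) / k`!%:R.
  by rewrite -big_split; apply: eq_bigr => k _; rewrite E !mulrDl.
congr (_ + _); first by apply: eq_bigr => k _; rewrite -derivSn.
case: N {hg} => [|N]; first by rewrite !big_ord0.
rewrite big_ord_recl !mul0r add0r; apply: eq_bigr => k _.
rewrite lift0 /= factS natrM -derivSn.
have h1 : (k`!%:R : R) != 0 by rewrite pnatr_eq0 -lt0n fact_gt0.
by field; rewrite h1 nat1r pnatr_eq0.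
Qed.

Lemma gauss1_sqr_ge0 (R : realType) (w : {poly R}) : 0 <= gauss1 (w ^+ 2).
Proof.
rewrite expr2 (gauss1_parseval _ (leqnn _)); apply: sumr_ge0 => k _.
by rewrite -expr2 divr_ge0 ?sqr_ge0 ?ler0n.
Qed.

(** A nonreal complex root a + ib contributes a real quadratic factor: the
    remainder of p modulo that quadratic has degree at most 1 and vanishes at a
    nonreal number. *)
Lemma rootless_poly_factor (R : realType) (p : {poly R}) :
  (forall x, p.[x] != 0) -> (1 < size p)%N ->
  exists (a b : R) (g : {poly R}), p = (('X - a%:P) ^+ 2 + (b ^+ 2)%:P) * g.
Proof.
move=> hp hs; pose toC : {rmorphism R -> R[i]} := real_complex R.
have /closed_rootP[z] : size (map_poly toC p) != 1.
  by rewrite size_map_poly; case: size hs => [|[]].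
move/rootP; case: z => a b hz.
have b0 : b != 0.
  apply: contraNneq (hp a) => b0; move: hz; rewrite b0 -[(_ +i* 0)%C]/(toC a).
  by rewrite horner_map => /eqP; rewrite fmorph_eq0.
pose Q : {poly R} := ('X - a%:P) ^+ 2 + (b ^+ 2)%:P.
have sQ : size Q = 3%N.
  rewrite size_polyDl size_exp_XsubC //.
  exact: leq_ltn_trans (size_polyC_leq1 _) _.
have Q0 : Q != 0 by rewrite -size_poly_gt0 sQ.
exists a, b, (p %/ Q); rewrite -/Q [LHS](divp_eq p Q) mulrC.
suff -> : p %% Q = 0 by rewrite addr0.
have : (size (p %% Q)%R < 3)%N by rewrite -sQ ltn_modp.
move: hz; rewrite [X in map_poly _ X](divp_eq p Q) rmorphD rmorphM hornerD hornerM.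
have -> : (map_poly toC Q).[(a +i* b)%C] = 0.
  rewrite /Q rmorphD rmorphXn rmorphB /= map_polyX !map_polyC /= !hornerE.
  by rewrite expr2; simpc; rewrite /toC; simpc; apply/eqP; rewrite eq_complex /=; apply/andP; split; apply/eqP; ring.
rewrite mulr0 add0r; set r := p %% Q => hr sr.
have er : r = (r`_1)%:P * 'X + (r`_0)%:P.
  apply/polyP => i; rewrite coefD coefMX !coefC.
  case: i => [|[|i]] /=; rewrite ?add0r ?addr0 //.
  by rewrite nth_default //; apply: (@leq_trans 2).
move: hr; rewrite er rmorphD rmorphM /= map_polyX !map_polyC /= !hornerE.
rewrite /toC; simpc => -[h1 h2].
have r1 : r`_1 = 0 by apply/eqP; move/eqP: h2; rewrite mulf_eq0 (negPf b0) orbF.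
by move: h1; rewrite r1 mul0r add0r => ->; rewrite mul0r addr0.
Qed.

(** The square w ^+ 2 carries the factors already removed from p, so that the
    induction on the degree of p never has to write p as an explicit sum of
    squares. *)
Lemma gauss1_pos (R : realType) (p w : {poly R}) :
  (forall x, 0 < p.[x]) -> 0 <= gauss1 (w ^+ 2 * p).
Proof.
have [m] := ubnP (size p); elim: m p w => // m IH p w hm hp.
have hp0 x : p.[x] != 0 by rewrite gt_eqF.
have [hs|/(rootless_poly_factor hp0)[a [b [g ep]]]] := leqP (size p) 1.
  rewrite (size1_polyC hs) mulrC mul_polyC gauss1Z.
  by rewrite mulr_ge0 ?gauss1_sqr_ge0 // -horner_coef0 ltW.
set Q := _ + _ in ep.
have Qpos x : 0 <= Q.[x] by rewrite /Q !hornerE addr_ge0 ?sqr_ge0.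
have gpos x : 0 < g.[x].
  move: (hp x); rewrite ep hornerM; have [//|hg] := ltP 0 (g.[x]).
  by rewrite ltNge mulr_ge0_le0.
have g0 : g != 0 by apply: contraTneq (gpos 0) => ->; rewrite horner0 ltxx.
have sQ : size Q = 3%N.
  rewrite size_polyDl size_exp_XsubC //.
  exact: leq_ltn_trans (size_polyC_leq1 _) _.
have Q0 : Q != 0 by rewrite -size_poly_gt0 sQ.
have hg : (size g < m)%N.
  by move: hm; rewrite ep size_mul // sQ addSn /= ltnS => /ltnW.
have -> : w ^+ 2 * p = (w * ('X - a%:P)) ^+ 2 * g + (b%:P * w) ^+ 2 * g.
  by rewrite ep /Q polyC_exp; ring.
by rewrite gauss1D addr_ge0 // IH.
Qed.

(** Adding a positive constant removes the real roots; it changes the functional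
    by that same constant. *)
Lemma gauss1_ge0 (R : realType) (p : {poly R}) :
  (forall x, 0 <= p.[x]) -> 0 <= gauss1 p.
Proof.
move=> hp; apply/ler_addgt0Pr => e e0.
rewrite -[e]gauss1C -gauss1D -[_ + _]mul1r -[1](expr1n _ 2).
by apply: gauss1_pos => x; rewrite hornerD hornerC ltr_wpDl.
Qed.

Lemma gauss1Xn (R : realType) (k : nat) : gauss1 'X^k = gmoment R k.
Proof.
rewrite (@gauss1_widen _ _ k.+1) ?size_polyXn // big_ord_recr /= coefXn eqxx mul1r.
rewrite big1 ?add0r // => i _.
by rewrite coefXn ltn_eqF ?mul0r // ltn_ord.
Qed.

Lemma gmomentSr (R : realType) (k : nat) : gmoment R k.+1 = k%:R * gmoment R k.-1.
Proof. by case: k => [|k] //=; rewrite mul0r. Qed.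

(** * The Gaussian functional in several variables *)

(** [phi i k] plays the part of the k-th power of the i-th variable: powers of a
    number evaluate that variable, Gaussian moments integrate it out.  Mixed
    choices occur in the proof of [gauss_ge0]. *)
Definition moment_functional (R : realType) (n : nat) (phi : 'I_n -> nat -> R)
    (p : {mpoly R[n]}) : R :=
  \sum_(m <- msupp p) p@_m * \prod_(i < n) phi i (m i).

Section MomentFunctional.
Variables (R : realType) (n : nat) (phi : 'I_n -> nat -> R).

Lemma moment_functional_widen (p : {mpoly R[n]}) (k : nat) : (msize p <= k)%N ->
  moment_functional phi p = \sum_(m : 'X_{1..n < k}) p@_m * \prod_(i < n) phi i ((m : 'X_{1..n}) i).
Proof.
move=> le_pk; set I : subFinType _ := 'X_{1..n < k}.
rewrite /moment_functional (big_mksub I) ?msupp_uniq //=; first last.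
  by move=> x /msize_mdeg_lt /leq_trans; apply.
rewrite big_rmcond //= => j /memN_msupp_eq0 ->.
by rewrite mul0r.
Qed.

Lemma moment_functional_is_linear : linear_for *%R (moment_functional phi).
Proof.
move=> a p q; pose k := (maxn (msize (a *: p + q)) (maxn (msize p) (msize q))).
rewrite !(@moment_functional_widen _ k) /k ?leq_max ?leqnn ?orbT //.
rewrite mulr_sumr -big_split /=; apply: eq_bigr => m _.
by rewrite mcoeffD mcoeffZ mulrDl mulrA.
Qed.

HB.instance Definition _ :=
  GRing.isLinear.Build R {mpoly R[n]} R *%R (moment_functional phi) moment_functional_is_linear.

Lemma moment_functionalX (m : 'X_{1..n}) : moment_functional phi 'X_[m] = \prod_(i < n) phi i (m i).
Proof. by rewrite /moment_functional msuppX big_seq1 mcoeffX eqxx mul1r. Qed.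
End MomentFunctional.

Section GaussianFunctional.
Variables (R : realType) (n : nat).

Definition gauss (p : {mpoly R[n]}) : R := moment_functional (fun=> gmoment R) p.

HB.instance Definition _ :=
  GRing.isLinear.Build R {mpoly R[n]} R *%R gauss (moment_functional_is_linear _).

Lemma gaussD : {morph gauss : p q / p + q}. Proof. exact: raddfD. Qed.
Lemma gaussB : {morph gauss : p q / p - q}. Proof. exact: raddfB. Qed.
Lemma gaussZ c p : gauss (c *: p) = c * gauss p. Proof. exact: linearZ. Qed.
Lemma gauss_sum (I : Type) (r : seq I) (P : pred I) (F : I -> {mpoly R[n]}) :
  gauss (\sum_(i <- r | P i) F i) = \sum_(i <- r | P i) gauss (F i).
Proof. exact: raddf_sum. Qed.

Lemma gaussC c : gauss c%:MP = c.
Proof.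
rewrite -[c%:MP]mulr1 mul_mpolyC gaussZ -mpolyX0 /gauss moment_functionalX big1 ?mulr1 //.
by move=> i _; rewrite mnmE.
Qed.

Lemma gauss_one : gauss 1 = 1. Proof. by rewrite -[1]mpolyC1 gaussC. Qed.

Lemma gauss_byparts (i : 'I_n) (p : {mpoly R[n]}) :
  gauss ('X_i * p) = gauss p^`M(i).
Proof.
rewrite [p]mpolyE mulr_sumr [mderiv i _]raddf_sum !gauss_sum.
apply: eq_bigr => m _; rewrite -scalerAr /= mderivZ !gaussZ.
congr (_ * _); rewrite -mpolyXD mderivX gaussZ /gauss !moment_functionalX.
rewrite (bigD1 i) //= [in RHS](bigD1 i) //= mulrA.
congr (_ * _); last first.
  apply: eq_bigr => j ne; rewrite !mnmE eq_sym (negPf ne) add0n subn0 //.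
by rewrite !mnmE eqxx add1n subn1 gmomentSr.
Qed.

(** The variables listed in A are integrated out and the others are kept as
    evaluation points.  Moving one more variable into A is an application of
    [gauss1_ge0] to the polynomial in that variable alone. *)
Lemma gauss_ge0 (p : {mpoly R[n]}) : (forall y, 0 <= p.@[y]) -> 0 <= gauss p.
Proof.
move=> hp; pose phi (A : seq _) y (i : 'I_n) k : R := if i \in A then gmoment R k else y i ^+ k.
suff H (A : seq 'I_n) y : 0 <= moment_functional (phi A y) p.
  have -> : gauss p = moment_functional (phi (enum 'I_n) (fun=> 0)) p.
    apply: eq_bigr => m _; congr (_ * _); apply: eq_bigr => i _.
    by rewrite /phi mem_enum.
  exact: H.
elim: A y => [|i A IH] y.
  by have := hp y; rewrite mevalE.
have [iA|iA] := boolP (i \in A).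
  have -> : moment_functional (phi (i :: A) y) p = moment_functional (phi A y) p; last exact: IH.
  apply: eq_bigr => m _; congr (_ * _); apply: eq_bigr => j _.
  by rewrite /phi inE; case: eqP => [->|] //; rewrite iA.
pose u : {poly R} := \sum_(m <- msupp p)
  (p@_m * \prod_(j < n | j != i) phi A y j (m j)) *: 'X^(m i).
have -> : moment_functional (phi (i :: A) y) p = gauss1 u.
  rewrite [gauss1 u]raddf_sum; apply: eq_bigr => m _.
  rewrite /= gauss1Z gauss1Xn (bigD1 i) //= /phi inE eqxx /= -mulrA.
  congr (_ * _); rewrite mulrC; congr (_ * _); apply: eq_bigr => j ne.
  by rewrite inE (negPf ne).
apply: gauss1_ge0 => x.
have -> : u.[x] = moment_functional (phi A (fun j => if j == i then x else y j)) p; last exact: IH.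
rewrite horner_sum; apply: eq_bigr => m _.
rewrite hornerZ hornerXn [in RHS](bigD1 i) //= /phi (negPf iA) eqxx -mulrA.
congr (_ * _); rewrite mulrC; congr (_ * _); apply: eq_bigr => j ne.
by rewrite (negPf ne).
Qed.

Lemma gauss_ext (p q : {mpoly R[n]}) : (forall y, p.@[y] = q.@[y]) -> gauss p = gauss q.
Proof.
move=> h; apply/eqP; rewrite eq_le -subr_ge0 -gaussB -[_ <= gauss p]subr_ge0 -gaussB.
by rewrite !gauss_ge0 // => y; rewrite mevalB h subrr.
Qed.

End GaussianFunctional.

(** * Sums over tuples of indices *)
Section TupleSums.
Variables (V : nmodType) (T : finType).

Lemma sum_tuple0 (F : seq T -> V) : \sum_(t : 0.-tuple T) F t = F [::].
Proof.
rewrite (eq_bigr (fun=> F [::])) => [|t _]; last by rewrite tuple0.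
by rewrite sumr_const card_tuple expn0 mulr1n.
Qed.

Lemma sum_tupleS (k : nat) (F : seq T -> V) :
  \sum_(t : k.+1.-tuple T) F t = \sum_i \sum_(t : k.-tuple T) F (i :: t).
Proof.
rewrite pair_big /=.
rewrite (reindex (fun p : T * k.-tuple T => [tuple of p.1 :: p.2])) //=.
exists (fun t => (thead t, [tuple of behead t])) => [[i t] _ | t _].
  by congr (_, _); apply: val_inj.
by apply: val_inj; rewrite /= [in RHS](tuple_eta t).
Qed.

Lemma sum_tupleD (k j : nat) (F : seq T -> V) :
  \sum_(t : (k + j).-tuple T) F t
    = \sum_(s : k.-tuple T) \sum_(u : j.-tuple T) F (s ++ u).
Proof.
elim: k F => [|k IH] F.
  by rewrite (@sum_tuple0 (fun s => \sum_(u : j.-tuple T) F (s ++ u))).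
rewrite (@sum_tupleS _ (fun s => \sum_(u : j.-tuple T) F (s ++ u))) [LHS](@sum_tupleS (k + j)).
by apply: eq_bigr => i _; rewrite (IH (fun t => F (i :: t))).
Qed.
End TupleSums.

(** * Forms and Hermite polynomials attached to a symmetric tensor *)
Section Raising.
Variables (R : realType) (n : nat).
Implicit Types (v : seq 'I_n -> R) (p q f g : {mpoly R[n]}) (i j : 'I_n).

(** Tensors of every order are represented by functions on sequences: slicing a
    tensor then changes its order without any cast.  Only the values on
    sequences of one length matter at a time. *)
Definition symmetric_fun v := forall s t, perm_eq s t -> v s = v t.

Definition slice v (s : seq 'I_n) : seq 'I_n -> R := fun t => v (s ++ t).

Lemma slice_sym v s : symmetric_fun v -> symmetric_fun (slice v s).
Proof. by move=> hv t u tu; apply: hv; rewrite perm_cat2l. Qed.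

Lemma slice_cat v s t : slice (slice v s) t = slice v (s ++ t).
Proof. by apply/funext => u; rewrite /slice catA. Qed.

Definition pderivs (s : seq 'I_n) p : {mpoly R[n]} := foldr (@mderiv n R) p s.

Lemma pderivsS i s p : pderivs (i :: s) p = pderivs s p^`M(i).
Proof. by elim: s => //= j s IH; rewrite -IH /= mderiv_comm. Qed.

Lemma pderivs_cat s t p : pderivs (s ++ t) p = pderivs s (pderivs t p).
Proof. exact: foldr_cat. Qed.

Lemma pderivsD s : {morph pderivs s : p q / p + q}.
Proof. by move=> p q; elim: s => //= i s ->; rewrite mderivD. Qed.

(** The order m tensor v evaluated on the operators C i, applied to 1.
    Multiplication by the variables produces the form with tensor v, creation
    operators produce its Hermite polynomial. *)
Fixpoint raise (C : 'I_n -> {mpoly R[n]} -> {mpoly R[n]}) (m : nat) v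
    : {mpoly R[n]} :=
  if m is m'.+1 then \sum_i C i (raise C m' (slice v [:: i])) else (v [::])%:MP.

Section CanonicalCommutation.
Variable C : 'I_n -> {mpoly R[n]} -> {mpoly R[n]}.
Hypothesis C_scal : forall j c p, C j (c *: p) = c *: C j p.
Hypothesis C_ccr : forall i j p, (C j p)^`M(i) = C j p^`M(i) + (i == j)%:R *: p.

(** Both families of operators satisfy the canonical commutation relation with
    the derivations, so differentiating removes one factor at a time, exactly as
    it does for a power. *)
Lemma mderiv_raise m v i : symmetric_fun v ->
  (raise C m v)^`M(i) = m%:R *: raise C m.-1 (slice v [:: i]).
Proof.
elim: m v => [|m IH] v hv /=; first by rewrite mderivC scale0r.
rewrite raddf_sum /=.
rewrite (eq_bigr (fun j => m%:R *: C j (raise C m.-1 (slice (slice v [:: i]) [:: j]))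
   + (i == j)%:R *: raise C m (slice v [:: i]))) => [|j _]; last first.
  rewrite C_ccr IH ?C_scal; last exact: slice_sym.
  have -> : slice (slice v [:: j]) [:: i] = slice (slice v [:: i]) [:: j].
    apply/funext => t; apply: hv => /=.
    exact/permPl/(perm_catCA [:: j] [:: i] t).
  by case: eqVneq => [->|] //; rewrite !scale0r.
rewrite big_split /= -scaler_sumr -scaler_suml.
rewrite -natr_sum.
have -> : (\sum_j (i == j))%N = 1%N.
  by rewrite (bigD1 i) //= eqxx big1 // => j; rewrite eq_sym => /negPf->.
case: m {IH} => [|m] /=; first by rewrite scale0r add0r.
by rewrite -scalerDl natr1.
Qed.

Lemma pderivs_raise m v s : symmetric_fun v ->
  pderivs s (raise C m v) = (m ^_ (size s))%:R *: raise C (m - size s) (slice v s).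
Proof.
move=> hv; elim: s => [|i s IH] /=.
  by rewrite ffactn0 scale1r subn0.
rewrite IH mderivZ mderiv_raise; last exact: slice_sym.
rewrite scalerA -natrM -ffactnSr subnS slice_cat.
congr (_ *: raise _ _ _); apply/funext => t; apply: hv.
by rewrite -cat1s -[i :: s]cat1s perm_cat2r perm_catC.
Qed.
End CanonicalCommutation.

Definition mulvar i p : {mpoly R[n]} := 'X_i * p.
Definition creation i p : {mpoly R[n]} := 'X_i * p - p^`M(i).

Lemma mderivXU i j : ('X_j : {mpoly R[n]})^`M(i) = (i == j)%:R.
Proof.
rewrite mderivX mnmE eq_sym; case: eqVneq => [->|]; last by rewrite scale0r.
by rewrite scale1r -mpolyX0; congr 'X_[_]; apply/mnmP => k; rewrite !mnmE subnn.
Qed.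

Lemma mulvar_scal j c p : mulvar j (c *: p) = c *: mulvar j p.
Proof. by rewrite /mulvar scalerAr. Qed.

Lemma mulvar_ccr i j p : (mulvar j p)^`M(i) = mulvar j p^`M(i) + (i == j)%:R *: p.
Proof. by rewrite /mulvar mderivM mderivXU addrC scaler_nat mulr_natl. Qed.

Lemma creation_scal j c p : creation j (c *: p) = c *: creation j p.
Proof. by rewrite /creation mderivZ scalerBr scalerAr. Qed.

Lemma creation_ccr i j p :
  (creation j p)^`M(i) = creation j p^`M(i) + (i == j)%:R *: p.
Proof. by rewrite /creation mderivB mulvar_ccr mderiv_comm addrAC. Qed.

Definition form m v := raise mulvar m v.
Definition hermite m v := raise creation m v.

Lemma pderivs_form m v s : symmetric_fun v ->
  pderivs s (form m v) = (m ^_ (size s))%:R *: form (m - size s) (slice v s).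
Proof. exact: pderivs_raise mulvar_scal mulvar_ccr _ _ _. Qed.

Lemma pderivs_hermite m v s : symmetric_fun v ->
  pderivs s (hermite m v) = (m ^_ (size s))%:R *: hermite (m - size s) (slice v s).
Proof. exact: pderivs_raise creation_scal creation_ccr _ _ _. Qed.

End Raising.

(** * Expansion of the expectation of a squared Hermite polynomial *)
Section HermiteExpansion.
Variables (R : realType) (n : nat).
Implicit Types (v : seq 'I_n -> R) (p q f g : {mpoly R[n]}).

Lemma gauss_creation f g i : gauss (f * creation i g) = gauss (f^`M(i) * g).
Proof.
rewrite /creation mulrBr gaussB mulrCA gauss_byparts mderivM gaussD.
by rewrite addrK.
Qed.

(** [gauss_creation], the adjointness of creation operators and derivations,
    iterated r times. *)
Lemma gauss_mul_hermite f v r :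
  gauss (f * hermite r v) = \sum_(t : r.-tuple 'I_n) v t * gauss (pderivs t f).
Proof.
elim: r f v => [|r IH] f v.
  rewrite (@sum_tuple0 _ _ (fun t => v t * gauss (pderivs t f))) /=.
  by rewrite mulrC mul_mpolyC gaussZ.
rewrite (@sum_tupleS _ _ _ (fun t => v t * gauss (pderivs t f))).
rewrite /hermite /= mulr_sumr gauss_sum; apply: eq_bigr => i _.
rewrite gauss_creation IH; apply: eq_bigr => t _.
by rewrite -!pderivsS.
Qed.

(** By symmetry of v, the C(r, k) ways of choosing which k of the r derivations
    act on f all contribute the same sum; the induction is Pascal's rule. *)
Lemma leibniz r v f g : symmetric_fun v ->
  \sum_(t : r.-tuple 'I_n) v t *: pderivs t (f * g)
  = \sum_(k < r.+1) 'C(r, k)%:R *: \sum_(a : k.-tuple 'I_n)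
      \sum_(b : (r - k).-tuple 'I_n) v (a ++ b) *: (pderivs a f * pderivs b g).
Proof.
pose S k j u p q : {mpoly R[n]} := \sum_(a : k.-tuple 'I_n)
      \sum_(b : j.-tuple 'I_n) u (a ++ b) *: (pderivs a p * pderivs b q).
rewrite -[RHS]/(\sum_(k < r.+1) 'C(r, k)%:R *: S k (r - k)%N v f g).
elim: r v f g => [|r IH] v f g hv.
  rewrite (@sum_tuple0 _ _ (fun t => v t *: pderivs t (f * g))) big_ord1 scale1r /S.
  rewrite (@sum_tuple0 _ _ (fun a => \sum_(b : 0.-tuple 'I_n)
     v (a ++ b) *: (pderivs a f * pderivs b g))).
  by rewrite (@sum_tuple0 _ _ (fun b => v b *: (f * pderivs b g))).
rewrite (@sum_tupleS _ _ _ (fun t => v t *: pderivs t (f * g))).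
have SL k j : \sum_i S k j (slice v [:: i]) f^`M(i) g = S k.+1 j v f g.
  rewrite /S (@sum_tupleS _ _ _ (fun a => \sum_(b : j.-tuple 'I_n)
     v (a ++ b) *: (pderivs a f * pderivs b g))).
  by do 3!(apply: eq_bigr => ? _); rewrite pderivsS.
have SR k j : \sum_i S k j (slice v [:: i]) f g^`M(i) = S k j.+1 v f g.
  rewrite /S exchange_big; apply: eq_bigr => a _ /=.
  rewrite (@sum_tupleS _ _ _ (fun b => v (a ++ b) *: (pderivs a f * pderivs b g))).
  do 2!(apply: eq_bigr => ? _); rewrite pderivsS; congr (_ *: _); apply: hv.
  by rewrite -cat1s -[in X in perm_eq _ X]cat1s; apply/permPl/perm_catCA.
(* SL and SR: an extra derivation may fall on f or on g. *)
transitivity (\sum_(k < r.+1) 'C(r, k)%:R *: (S k.+1 (r - k)%N v f g + S k (r - k).+1 v f g)).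
  rewrite (eq_bigr (fun i => \sum_(k < r.+1) 'C(r, k)%:R *:
     (S k (r - k)%N (slice v [:: i]) f^`M(i) g + S k (r - k)%N (slice v [:: i]) f g^`M(i)))).
    rewrite exchange_big; apply: eq_bigr => k _.
    by rewrite -scaler_sumr big_split /= SL SR.
  move=> i _.
  under [RHS]eq_bigr do rewrite scalerDr.
  rewrite big_split /= -!IH; try exact: slice_sym.
  rewrite -big_split; apply: eq_bigr => t _ /=.
  by rewrite -[mderiv i _]/(pderivs [:: i] _) -pderivs_cat pderivsS mderivM pderivsD scalerDr.
under eq_bigr do rewrite scalerDr.
rewrite big_split /= addrC [in RHS]big_ord_recl /= bin0 scale1r.
under [in RHS]eq_bigr do rewrite binS natrD scalerDl ?subSS.
rewrite [in RHS]big_split /= addrA; congr (_ + _).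
rewrite big_ord_recl /= bin0 scale1r !subn0; congr (_ + _).
rewrite [in RHS]big_ord_recr /= bin_small // scale0r addr0.
by apply: eq_bigr => k _; rewrite subnSK.
Qed.

(** One factor h_v is turned into derivations by adjointness; those that fall on
    the other factor h_v lower it to the Hermite polynomial of a slice of v,
    which is again turned into derivations of q. *)
Lemma gauss_hermite_sqr q v r : symmetric_fun v ->
  gauss (q * hermite r v * hermite r v) =
  \sum_(k < r.+1) ('C(r, k) * r ^_ (r - k))%:R * \sum_(a : k.-tuple 'I_n)
    \sum_(c : k.-tuple 'I_n) gauss (pderivs (a ++ c) q) *
    \sum_(b : (r - k).-tuple 'I_n) v (a ++ b) * v (c ++ b).
Proof.
move=> hv; rewrite gauss_mul_hermite.
under eq_bigr do rewrite -gaussZ.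
rewrite -gauss_sum leibniz // gauss_sum; apply: eq_bigr => k _.
rewrite gaussZ natrM -mulrA; congr (_ * _).
rewrite gauss_sum mulr_sumr; apply: eq_bigr => a _.
rewrite gauss_sum.
under eq_bigr => b _.
  rewrite gaussZ pderivs_hermite // size_tuple -scalerAr gaussZ subKn -1?ltnS ?ltn_ord //.
  rewrite gauss_mul_hermite mulrCA.
  over.
rewrite -mulr_sumr; congr (_ * _).
under eq_bigr do rewrite mulr_sumr.
rewrite exchange_big; apply: eq_bigr => c _ /=; rewrite mulr_sumr.
apply: eq_bigr => b _; rewrite -pderivs_cat.
rewrite [in RHS]mulrC -!mulrA; congr (_ * (_ * _)).
  by apply: hv; rewrite perm_catC.
rewrite /pderivs; congr gauss; apply: mderiv_perm.
by rewrite perm_catC.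
Qed.

End HermiteExpansion.

(** * The Gaussian moment tensor and bounds on derivatives *)
Section Bounds.
Variables (R : realType) (n : nat).
Implicit Types (v u A : seq 'I_n -> R) (p q f g : {mpoly R[n]}).

Definition sqsum m v : R := \sum_(t : m.-tuple 'I_n) v t ^+ 2.

Lemma sqsum_ge0 m v : 0 <= sqsum m v.
Proof. by apply: sumr_ge0 => t _; exact: sqr_ge0. Qed.

(** The quadratic form of A (x) I^(x e) at the tensor v of order d + e. *)
Definition qform d e A v : R :=
  \sum_(a : d.-tuple 'I_n) \sum_(c : d.-tuple 'I_n) A (a ++ c) *
    \sum_(b : e.-tuple 'I_n) v (a ++ b) * v (c ++ b).

Definition monom (s : seq 'I_n) : {mpoly R[n]} := \prod_(i <- s) 'X_i.

Lemma formE m v : form m v = \sum_(t : m.-tuple 'I_n) v t *: monom t.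
Proof.
rewrite /form; elim: m v => [|m IH] v /=.
  by rewrite (@sum_tuple0 _ _ (fun t => v t *: monom t)) /monom big_nil alg_mpolyC.
rewrite (@sum_tupleS _ _ _ (fun t => v t *: monom t)); apply: eq_bigr => i _.
rewrite IH /mulvar mulr_sumr; apply: eq_bigr => t _.
by rewrite -scalerAr /monom big_cons.
Qed.

Lemma meval_monom s (y : 'I_n -> R) : (monom s).@[y] = \prod_(i <- s) y i.
Proof. by rewrite /monom rmorph_prod; apply: eq_bigr => i _ /=; rewrite mevalXU. Qed.

Lemma meval_form m v (y : 'I_n -> R) :
  (form m v).@[y] = \sum_(t : m.-tuple 'I_n) v t * \prod_(i <- t) y i.
Proof.
by rewrite formE rmorph_sum; apply: eq_bigr => t _ /=; rewrite mevalZ meval_monom.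
Qed.

Lemma gauss_pderivs_form m v (t : m.-tuple 'I_n) : symmetric_fun v ->
  gauss (pderivs t (form m v)) = m`!%:R * v t.
Proof.
move=> hv; rewrite pderivs_form // size_tuple subnn ffactnn gaussZ /form /= gaussC.
by rewrite /slice cats0.
Qed.

Lemma gauss_pderivs_hermite m v (t : m.-tuple 'I_n) : symmetric_fun v ->
  gauss (pderivs t (hermite m v)) = m`!%:R * v t.
Proof.
move=> hv; rewrite pderivs_hermite // size_tuple subnn ffactnn gaussZ /hermite /= gaussC.
by rewrite /slice cats0.
Qed.

(** The Hermite polynomial h_u is the orthogonal projection of the form of u on
    the Hermite polynomials of degree m: its inner product with that form and its
    own squared norm both equal m! |u|^2.  Hence the claim is the nonnegativity
    of the squared norm of the difference. *)
Lemma gauss_form_sqr_ge m u : symmetric_fun u ->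
  m`!%:R * sqsum m u <= gauss (form m u ^+ 2).
Proof.
move=> hu; have h0 : 0 <= gauss ((form m u - hermite m u) ^+ 2).
  by apply: gauss_ge0 => y; rewrite rmorphXn sqr_ge0.
have hs : \sum_(t : m.-tuple 'I_n) u t * (m`!%:R * u t) = m`!%:R * sqsum m u.
  by rewrite mulr_sumr; apply: eq_bigr => t _; rewrite mulrCA expr2.
have e1 : gauss (form m u * hermite m u) = m`!%:R * sqsum m u.
  by rewrite gauss_mul_hermite -hs; apply: eq_bigr => t _; rewrite gauss_pderivs_form.
have e2 : gauss (hermite m u * hermite m u) = m`!%:R * sqsum m u.
  by rewrite gauss_mul_hermite -hs; apply: eq_bigr => t _; rewrite gauss_pderivs_hermite.
move: h0; rewrite sqrrB gaussD gaussB -mulr_natl mulr_natl [X in _ - X]raddfMn /=.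
rewrite e1 [X in _ + gauss X]expr2 e2; lra.
Qed.

Definition gtensor (s : seq 'I_n) : R := gauss (monom s).

Lemma gtensor_sym : symmetric_fun gtensor.
Proof. by move=> s t st; rewrite /gtensor /monom (perm_big _ st). Qed.

(** The moment tensor is an average of squares of pure tensors, so its lifted
    form at v is the sum, over the e contracted indices, of the second moments of
    the corresponding slices of v. *)
Lemma qform_gtensor_ge d e v : symmetric_fun v ->
  d`!%:R * sqsum (d + e) v <= qform d e gtensor v.
Proof.
move=> hv; rewrite /sqsum (@sum_tupleD _ _ _ _ (fun t => v t ^+ 2)).
rewrite exchange_big mulr_sumr.
have -> : qform d e gtensor v =
    \sum_(b : e.-tuple 'I_n) gauss (form d (fun a => v (a ++ b)) ^+ 2).
  rewrite /qform.
  under eq_bigr do under eq_bigr do rewrite mulr_sumr.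
  under eq_bigr do rewrite exchange_big.
  rewrite exchange_big; apply: eq_bigr => b _ /=.
  rewrite formE expr2 mulr_suml gauss_sum; apply: eq_bigr => a _.
  rewrite mulr_sumr gauss_sum; apply: eq_bigr => c _.
  rewrite -scalerAl -scalerAr !gaussZ /gtensor /monom big_cat /=.
  by rewrite mulrC mulrA.
apply: ler_sum => b _; apply: gauss_form_sqr_ge => s t st.
by apply: hv; rewrite perm_cat2r.
Qed.

(** The left-hand side is the moment of order 2d of the linear form l with
    coefficients y, a Gaussian variable of variance |y|^2. *)
Lemma meval_form_gtensor d (y : 'I_n -> R) :
  (form (2 * d) gtensor).@[y] = gmoment R (2 * d) * (\sum_i y i ^+ 2) ^+ d.
Proof.
pose l : {mpoly R[n]} := \sum_i y i *: 'X_i.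
have -> : (form (2 * d) gtensor).@[y] = gauss (l ^+ (2 * d)).
  rewrite meval_form.
  have -> : l ^+ (2 * d) =
      \sum_(t : (2 * d).-tuple 'I_n) (\prod_(i <- t) y i) *: monom t.
    elim: (2 * d)%N => [|m IH].
      rewrite (@sum_tuple0 _ _ (fun t => (\prod_(i <- t) y i) *: monom t)).
      by rewrite /monom !big_nil scale1r.
    rewrite (@sum_tupleS _ _ _ (fun t => (\prod_(i <- t) y i) *: monom t)).
    rewrite exprS /l mulr_suml IH; apply: eq_bigr => i _.
    rewrite mulr_sumr; apply: eq_bigr => t _.
    by rewrite -scalerAl -scalerAr scalerA /monom !big_cons.
  by rewrite gauss_sum; apply: eq_bigr => t _; rewrite gaussZ mulrC.
have dl m i : (l ^+ m)^`M(i) = (m%:R * y i) *: l ^+ m.-1.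
  elim: m => [|m IH]; first by rewrite mul0r scale0r expr0 -mpolyC1 mderivC.
  rewrite exprS mderivM IH /l raddf_sum /= (bigD1 i) //= mderivZ mderivXU eqxx.
  rewrite big1 => [|j ne]; last by rewrite mderivZ mderivXU eq_sym (negPf ne) scaler0.
  rewrite addr0 -/l -scalerAr -scalerAl mul1r -[m.+1%:R]nat1r mulrDl mul1r scalerDl.
  congr (_ + _); case: m {IH} => [|m]; first by rewrite mul0r !scale0r.
  by rewrite -exprS.
elim: d => [|d IH]; first by rewrite !expr0 gauss_one mulr1.
rewrite mulnS [l ^+ _]exprS {1}/l mulr_suml gauss_sum.
under eq_bigr do rewrite -scalerAl gaussZ gauss_byparts dl gaussZ IH.
rewrite [_ ^+ d.+1]exprS mulr_suml mulr_sumr; apply: eq_bigr => i _.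
rewrite [gmoment R (2 + 2 * d)]gmomentSr /=.
by ring.
Qed.

Lemma gmoment_even_gt0 d : 0 < gmoment R (2 * d).
Proof.
elim: d => [|d IH]; first by rewrite muln0.
by rewrite mulnS gmomentSr mulr_gt0 // ltr0n.
Qed.

Definition indicator_at (s t : seq 'I_n) : R := (t == s)%:R.

Lemma gauss_pderivsE s q : gauss (pderivs s q) = gauss (q * hermite (size s) (indicator_at s)).
Proof.
rewrite gauss_mul_hermite (bigD1 (in_tuple s)) //= /indicator_at eqxx mul1r.
rewrite big1 ?addr0 // => t ne; case: eqP => [e|]; last by rewrite mul0r.
by case/eqP: ne; apply: val_inj.
Qed.

Definition deriv_bound d s : R :=
  gauss ((sqnorm R n) ^+ d * (1 + hermite (size s) (indicator_at s) ^+ 2)) / 2%:R.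

Lemma meval_sqnorm (y : 'I_n -> R) : (sqnorm R n).@[y] = \sum_i y i ^+ 2.
Proof.
by rewrite /sqnorm rmorph_sum; apply: eq_bigr => i _; rewrite rmorphXn /= mevalXU.
Qed.

(** By adjointness the expectation of the derivative is that of q h, with h a
    Hermite polynomial.  Positivity applied to q (1 + h)^2 and q (1 - h)^2 bounds
    twice its absolute value by the expectation of q (1 + h^2), where q may be
    replaced by K s^d. *)
Lemma gauss_pderivs_le d s q (K : R) :
  (forall y, 0 <= q.@[y] <= K * (\sum_i y i ^+ 2) ^+ d) ->
  `|gauss (pderivs s q)| <= K * deriv_bound d s.
Proof.
move=> hq; rewrite gauss_pderivsE /deriv_bound; set h := hermite _ _.
have hK : gauss (q * (1 + h ^+ 2)) <= K * gauss ((sqnorm R n) ^+ d * (1 + h ^+ 2)).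
  rewrite -subr_ge0 -gaussZ -gaussB; apply: gauss_ge0 => y.
  rewrite mevalB mevalZ !mevalM rmorphXn /= meval_sqnorm mevalD meval1 rmorphXn /=.
  rewrite mulrA -mulrBl mulr_ge0 ?subr_ge0 ?addr_ge0 ?sqr_ge0 //.
  by case/andP: (hq y).
have hpos (e : R) : e ^+ 2 = 1 -> 0 <= gauss (q * (1 + h ^+ 2)) + e * 2%:R * gauss (q * h).
  move=> he; have -> : gauss (q * (1 + h ^+ 2)) + e * 2%:R * gauss (q * h) =
     gauss (q * (1 + e *: h) ^+ 2).
    rewrite -gaussZ -gaussD; congr gauss.
    rewrite sqrrD expr1n mul1r exprZn he scale1r -!mul_mpolyC mpolyCM mpolyC_nat.
    ring.
  apply: gauss_ge0 => y; rewrite mevalM rmorphXn mulr_ge0 ?sqr_ge0 //.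
  by case/andP: (hq y).
have h1 := hpos 1 (expr1n _ _); have h2 := hpos (-1) (etrans (sqrrN _) (expr1n _ _)).
by rewrite ler_norml; apply/andP; split; lra.
Qed.

End Bounds.

(** * Approximate positivity of the lifted form *)
Section LowerBound.
Variables (R : realType) (n : nat).
Implicit Types (v u A : seq 'I_n -> R) (p q f g : {mpoly R[n]}).

Lemma norm_partial_trace_le k j v (a c : k.-tuple 'I_n) :
  `|\sum_(b : j.-tuple 'I_n) v (a ++ b) * v (c ++ b)| <= sqsum (k + j) v.
Proof.
have H (s : k.-tuple 'I_n) :
    \sum_(b : j.-tuple 'I_n) v (s ++ b) ^+ 2 <= sqsum (k + j) v.
  rewrite /sqsum (@sum_tupleD _ _ _ _ (fun t => v t ^+ 2)) (bigD1 s) //= lerDl.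
  by apply: sumr_ge0 => t _; apply: sumr_ge0 => b _; exact: sqr_ge0.
have Ha := H a; have Hc := H c.
apply: le_trans (ler_norm_sum _ _ _) _.
apply: (@le_trans _ _ (\sum_(b : j.-tuple 'I_n)
    (v (a ++ b) ^+ 2 + v (c ++ b) ^+ 2) / 2%:R)).
  apply: ler_sum => b _; rewrite ler_norml.
  have h1 := sqr_ge0 (v (a ++ b) + v (c ++ b)).
  have h2 := sqr_ge0 (v (a ++ b) - v (c ++ b)).
  by rewrite sqrrD in h1; rewrite sqrrB in h2; apply/andP; split; lra.
rewrite -mulr_suml big_split /=; lra.
Qed.

(** The quotient of the weights at d and k is r^_d / r^_k up to constants, and
    this quotient has at least one factor, each at least r - d + 1 = e.+1. *)
Lemma hermite_weight_le d e k : (k < d)%N ->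
  ('C(d + e, k) * (d + e) ^_ (d + e - k) * e.+1
    <= 'C(d + e, d) * (d + e) ^_ e * d`! ^ 2)%N.
Proof.
move=> kd; set r := (d + e)%N.
have -> : ('C(r, d) * r ^_ e * d`! ^ 2 = r ^_ d * r`!)%N.
  have h : (r ^_ e * d`! = r`!)%N.
    by rewrite -(@ffact_fact r e) ?leq_addl // /r addnK.
  by rewrite -(bin_ffact r d) -h expnS expn1; ring.
apply: (@leq_trans (r ^_ k * e.+1 * r`!)).
  rewrite mulnAC; apply: leq_mul.
    by rewrite leq_mul2r -(bin_ffact r k) leq_pmulr ?fact_gt0 ?orbT.
  rewrite -(@ffact_fact r (r - k)) ?leq_subr // leq_pmulr ?fact_gt0 //.
rewrite leq_mul2r; apply/orP; right.
have H m : (k < m <= d)%N -> (r ^_ k * e.+1 <= r ^_ m)%N.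
  elim: m => // m IH /andP[km md]; rewrite ffactnSr.
  have hm : (e.+1 <= r - m)%N by rewrite /r; lia.
  move: km; rewrite ltnS leq_eqVlt => /orP[/eqP->|km].
    by rewrite leq_mul2l hm orbT.
  have := IH _; rewrite km (ltnW md) => /(_ isT) /leq_trans; apply.
  by rewrite leq_pmulr //; apply: leq_trans hm.
by apply: H; rewrite kd leqnn.
Qed.

Definition remainder_const d : R :=
  d`!%:R ^+ 2 * \sum_(k < d) \sum_(a : k.-tuple 'I_n) \sum_(c : k.-tuple 'I_n)
    deriv_bound R d (a ++ c).

Lemma deriv_bound_ge0 d (s : seq 'I_n) : 0 <= deriv_bound R d s.
Proof.
rewrite divr_ge0 ?ler0n //; apply: gauss_ge0 => y.
rewrite mevalM rmorphXn /= meval_sqnorm mulr_ge0 ?exprn_ge0 //.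
  by apply: sumr_ge0 => i _; exact: sqr_ge0.
by rewrite mevalD meval1 rmorphXn addr_ge0 ?sqr_ge0.
Qed.

Lemma remainder_const_ge0 d : 0 <= remainder_const d.
Proof.
rewrite mulr_ge0 ?exprn_ge0 ?ler0n //.
by do 3!(apply: sumr_ge0 => ? _); exact: deriv_bound_ge0.
Qed.

(** The expansion of the nonnegative number E[q h_v^2] is solved for its term of
    index d, the only one that involves A through [qform]. *)
Lemma qform_ge d e A v (K : R) : symmetric_fun A -> symmetric_fun v ->
  (forall y, 0 <= (form (2 * d) A).@[y] <= K * (\sum_i y i ^+ 2) ^+ d) ->
  - (K * remainder_const d * sqsum (d + e) v) / e.+1%:R <= qform d e A v.
Proof.
move=> hA hv hq; set q := form _ A in hq.
pose T k j := \sum_(a : k.-tuple 'I_n) \sum_(c : k.-tuple 'I_n)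
    gauss (pderivs (a ++ c) q) * \sum_(b : j.-tuple 'I_n) v (a ++ b) * v (c ++ b).
pose w k := ('C(d + e, k) * (d + e) ^_ (d + e - k))%N.
pose B k : R := \sum_(a : k.-tuple 'I_n) \sum_(c : k.-tuple 'I_n)
    deriv_bound R d (a ++ c).
set N := sqsum _ v.
have hN k (a c : k.-tuple 'I_n) : (k < d)%N ->
    `|\sum_(b : (d + e - k).-tuple 'I_n) v (a ++ b) * v (c ++ b)| <= N.
  move=> kd; have e1 : (k + (d + e - k) = d + e)%N by lia.
  by rewrite /N -[X in sqsum X v]e1; exact: norm_partial_trace_le.
have N0 : 0 <= N by exact: sqsum_ge0.
clearbody N.
have Tle k : (k < d)%N -> `|T k (d + e - k)%N| <= K * B k * N.
  move=> kd.
  apply: le_trans (ler_norm_sum _ _ _) _.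
  rewrite /B mulr_sumr mulr_suml; apply: ler_sum => a _.
  apply: le_trans (ler_norm_sum _ _ _) _.
  rewrite mulr_sumr mulr_suml; apply: ler_sum => c _.
  by rewrite normrM; apply: ler_pM => //; [exact: gauss_pderivs_le | exact: hN].
have Td : T d e = (2 * d)`!%:R * qform d e A v.
  rewrite /qform mulr_sumr; apply: eq_bigr => a _; rewrite mulr_sumr.
  apply: eq_bigr => c _; rewrite mulrA; congr (_ * _).
  rewrite pderivs_form // size_cat !size_tuple addnn -mul2n ffactnn subnn gaussZ.
  by rewrite /form /= gaussC /slice cats0.
have T0 k j : (d < k)%N -> T k j = 0.
  move=> dk; apply: big1 => a _; apply: big1 => c _.
  rewrite pderivs_form // size_cat !size_tuple ffact_small; last by lia.
  by rewrite scale0r /gauss [moment_functional _ _]raddf0 mul0r.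
have : 0 <= gauss (q * hermite (d + e) v * hermite (d + e) v).
  apply: gauss_ge0 => y; rewrite -mulrA -expr2 mevalM rmorphXn mulr_ge0 ?sqr_ge0 //.
  by case/andP: (hq y).
rewrite gauss_hermite_sqr //.
rewrite -[X in 0 <= X]/(\sum_(k < (d + e).+1) (w k)%:R * T k (d + e - k)%N).
rewrite -(big_mkord xpredT (fun k => (w k)%:R * T k (d + e - k)%N)).
rewrite (@big_cat_nat _ _ _ d) //=; last by lia.
rewrite [X in _ + X]big_ltn; last by lia.
rewrite [X in _ + (_ + X)]big1_seq => [|k]; last first.
  by rewrite mem_index_iota => /andP[_ /andP[dk _]]; rewrite T0 // mulr0.
rewrite addr0 addKn Td big_mkord.
have wd0 : (0 < w d)%N by rewrite muln_gt0 bin_gt0 ffact_gt0; lia.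
move=> h.
(* X is the bound on the terms of index below d, after division by w d. *)
pose X := \sum_(k < d) d`!%:R ^+ 2 / e.+1%:R * (K * B k * N).
have Z0 (k : 'I_d) : 0 <= K * B k * N.
  exact: le_trans (normr_ge0 _) (Tle k (ltn_ord k)).
have XE : X = K * remainder_const d * N / e.+1%:R.
  have -> : remainder_const d = d`!%:R ^+ 2 * \sum_(k < d) B k by [].
  by rewrite /X -mulr_sumr -mulr_suml -mulr_sumr mulrAC !mulrA [_ * K]mulrC !mulrA.
have X0 : 0 <= X.
  by apply: sumr_ge0 => k _; rewrite mulr_ge0 ?divr_ge0 ?exprn_ge0 ?ler0n.
have hsum : \sum_(k < d) (w k)%:R * T k (d + e - k)%N <= (w d)%:R * X.
  rewrite /X mulr_sumr; apply: ler_sum => k _.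
  apply: (@le_trans _ _ ((w k)%:R * (K * B k * N))).
    by rewrite ler_wpM2l ?ler0n // (le_trans (ler_norm _) (Tle k (ltn_ord k))).
  rewrite [leRHS]mulrA; apply: ler_wpM2r => //.
  rewrite mulrA ler_pdivlMr ?ltr0n // -natrX -!natrM ler_nat.
  by have := hermite_weight_le e (ltn_ord k); rewrite -/(w k) /w addKn.
rewrite mulNr -XE.
have wpos : 0 < (w d)%:R :> R by rewrite ltr0n.
have h2 : 0 <= X + (2 * d)`!%:R * qform d e A v.
  by rewrite -(pmulr_rge0 _ wpos) mulrDr; apply: le_trans h _; rewrite lerD2r.
have f1 : 1 <= (2 * d)`!%:R :> R by rewrite ler1n fact_gt0.
have [F0|F0] := leP 0 (qform d e A v); first by apply: le_trans F0; rewrite oppr_le0.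
nra.
Qed.
End LowerBound.

(** * Homogeneous polynomials and symmetric tensors *)
Section Polarization.
Variables (R : realType) (n : nat).
Implicit Types (v u A : seq 'I_n -> R) (p q f g : {mpoly R[n]}).

Lemma euler_homog m f : f \is m.-homog -> \sum_i mulvar i f^`M(i) = m%:R *: f.
Proof.
move=> /dhomogP hf; rewrite [f in RHS]mpolyE scaler_sumr.
transitivity (\sum_i \sum_(mm <- msupp f) f@_mm *: mulvar i 'X_[mm]^`M(i)).
  apply: eq_bigr => i _; rewrite {1}[f]mpolyE raddf_sum /mulvar mulr_sumr.
  by apply: eq_bigr => mm _ /=; rewrite mderivZ scalerAr.
rewrite exchange_big /=; apply: eq_big_seq => mm hm.
rewrite -scaler_sumr scalerA mulrC -scalerA; congr (_ *: _).
rewrite -(hf _ hm) /= mdegE natr_sum scaler_suml; apply: eq_bigr => i _.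
rewrite /mulvar mderivX -scalerAr.
have [->|nz] := eqVneq (mm i) 0%N; first by rewrite !scale0r.
congr (_ *: _); rewrite -mpolyXD; congr 'X_[_].
apply/mnmP => j; rewrite !mnmE; case: eqVneq => [<-|] /=; last by rewrite subn0.
by rewrite subnKC // lt0n.
Qed.

Lemma mderiv_homog m f i : f \is m.+1.-homog -> f^`M(i) \is m.-homog.
Proof.
move=> /dhomogP hf; apply/dhomogP => mm.
rewrite mcoeff_msupp mcoeff_deriv => nz.
have /hf : (mm + U_(i))%MM \in msupp f.
  by rewrite mcoeff_msupp; apply: contraNneq nz => ->; rewrite mul0rn.
by rewrite /= mdegD mdeg1 addn1 => -[].
Qed.

Lemma form_taylor m f : f \is m.-homog ->
  form m (fun w => (pderivs w f)@_0) = m`!%:R *: f.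
Proof.
rewrite /form; elim: m f => [|m IH] f hf /=.
  rewrite scale1r; apply/mpolyP => mm; rewrite mcoeffC /=.
  have [->|nz] := eqVneq 0%MM mm; first by rewrite mulr1.
  rewrite mulr0 (dhomog_nemf_coeff hf) //.
  by rewrite mdeg_eq0 eq_sym.
have E i : slice (fun w => (pderivs w f)@_0) [:: i] = (fun w => (pderivs w f^`M(i))@_0).
  by apply/funext => t; rewrite /slice cat1s pderivsS.
under eq_bigr => i _ do rewrite E (IH _ (mderiv_homog i hf)) mulvar_scal.
by rewrite -scaler_sumr (euler_homog hf) scalerA -natrM factS mulnC.
Qed.

(** The tensor of f consists of its partial derivatives of order m divided by m!;
    their symmetry is the commutation of the derivations. *)
Lemma form_exists m f : f \is m.-homog ->
  exists A, symmetric_fun A /\ form m A = f.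
Proof.
move=> hf; exists (fun w => m`!%:R^-1 * (pderivs w f)@_0); split.
  by move=> s t st; rewrite /pderivs (mderiv_perm _ st).
have nz : (m`!%:R : R) != 0 by rewrite pnatr_eq0 -lt0n fact_gt0.
apply: (scalerI nz); rewrite -(form_taylor hf) !formE scaler_sumr.
by apply: eq_bigr => t _; rewrite scalerA mulVKf.
Qed.

(** The entries of a tensor are expectations of its form times Hermite
    polynomials, hence are determined by the values of the form. *)
Lemma form_inj m A B (t : m.-tuple 'I_n) : symmetric_fun A -> symmetric_fun B ->
  (forall y, (form m A).@[y] = (form m B).@[y]) -> A t = B t.
Proof.
move=> hA hB h; have nz : (m`!%:R : R) != 0 by rewrite pnatr_eq0 -lt0n fact_gt0.
apply: (mulfI nz); rewrite -!gauss_pderivs_form // !gauss_pderivsE.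
by apply: gauss_ext => y; rewrite !mevalM h.
Qed.
End Polarization.

(** * Matrices indexed by tuples as functions on sequences *)
Section Tensors.
Variables (R : realType) (n : nat).

Lemma sum_tdim r (F : 'I_(tdim n r) -> R) :
  \sum_a F a = \sum_(t : r.-tuple 'I_n) F (enum_rank t).
Proof. by rewrite (reindex _ (onW_bij _ (@enum_rank_bij _))). Qed.

Lemma tentry_tmx r F (t u : r.-tuple 'I_n) : tentry (@tmx R n r F) t u = F t u.
Proof. by rewrite /tentry mxE !enum_rankK. Qed.

Lemma cat_tleft_tright a b (t : (a + b).-tuple 'I_n) : tleft t ++ tright t = t :> seq _.
Proof.
suff e : t = [tuple of tleft t ++ tright t] by rewrite [RHS](congr1 (@tval _ _) e).
apply: eq_from_tnth => i; case: (split_ordP i) => j ->.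
  by rewrite tnth_lshift tnth_mktuple.
by rewrite tnth_rshift tnth_mktuple.
Qed.

Lemma tleft_cat a b (s : a.-tuple 'I_n) (u : b.-tuple 'I_n) :
  tleft [tuple of s ++ u] = s.
Proof. by apply: eq_from_tnth => i; rewrite tnth_mktuple tnth_lshift. Qed.

Lemma tright_cat a b (s : a.-tuple 'I_n) (u : b.-tuple 'I_n) :
  tright [tuple of s ++ u] = u.
Proof. by apply: eq_from_tnth => i; rewrite tnth_mktuple tnth_rshift. Qed.

Definition seqfun r (F : r.-tuple 'I_n -> R) (s : seq 'I_n) : R :=
  oapp F 0 (insub s).

Lemma seqfunE r F (t : r.-tuple 'I_n) : seqfun F t = F t.
Proof. by rewrite /seqfun valK. Qed.

Lemma seqfun_sym r (F : r.-tuple 'I_n -> R) :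
  (forall (s : 'S_r) t, F (tact s t) = F t) -> symmetric_fun (seqfun F).
Proof.
move=> hF s t st; rewrite /seqfun; case: insubP => [u _ us | hs].
  have ht : size t == r by rewrite -(perm_size st) -us size_tuple.
  have := hF; rewrite -[t]/(val (Tuple ht)) valK /=.
  have /tuple_permP[p e] : perm_eq s (Tuple ht) by [].
  move=> /(_ p (Tuple ht)) <-; congr F; apply: val_inj; rewrite us e /=.
  by [].
by rewrite insubN // -(perm_size st).
Qed.

Definition tensorfun d (A : 'M[R]_(tdim n d)) : seq 'I_n -> R :=
  seqfun (fun t : (d + d).-tuple 'I_n => tentry A (tleft t) (tright t)).

Lemma tensorfunE d (A : 'M[R]_(tdim n d)) (a c : d.-tuple 'I_n) :
  tensorfun A (a ++ c) = tentry A a c.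
Proof.
by rewrite /tensorfun -[a ++ c]/(tval [tuple of a ++ c]) seqfunE tleft_cat tright_cat.
Qed.

Lemma tensorfun_sym d (A : 'M[R]_(tdim n d)) : maxsym A -> symmetric_fun (tensorfun A).
Proof. exact: seqfun_sym. Qed.

Lemma meval_form_tensorfun d (A : 'M[R]_(tdim n d)) (x : 'cV[R]_n) :
  \tr (A^T *m tpow (x *m x^T) d) = (form (2 * d) (tensorfun A)).@[fun i => x i 0].
Proof.
rewrite mul2n -addnn meval_form.
rewrite (@sum_tupleD _ _ _ _ (fun t => tensorfun A t * \prod_(i <- t) x i 0)).
rewrite /mxtrace sum_tdim exchange_big /=; apply: eq_bigr => c _.
rewrite !mxE sum_tdim; apply: eq_bigr => a _.
rewrite tensorfunE !mxE /tentry !enum_rankK big_cat /= !big_tuple -big_split.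
congr (_ * _); apply: eq_bigr => i _ /=.
by rewrite mxE big_ord1 mxE.
Qed.

Definition vecfun r (v : 'rV[R]_(tdim n r)) : seq 'I_n -> R :=
  seqfun (fun t : r.-tuple 'I_n => v 0 (enum_rank t)).

Lemma vecfun_sym r (v : 'rV[R]_(tdim n r)) :
  (v <= symT R n r)%MS -> symmetric_fun (vecfun v).
Proof. by move/symTP => hv; apply: seqfun_sym. Qed.

Lemma sum_tuple_eq (k : nat) (t : k.-tuple 'I_n) (F : k.-tuple 'I_n -> R) :
  \sum_(u : k.-tuple 'I_n) (t == u)%:R * F u = F t.
Proof.
rewrite (bigD1 t) //= eqxx mul1r big1 ?addr0 // => u.
by rewrite eq_sym => /negPf->; rewrite mul0r.
Qed.

Lemma sum_tuple_cat a b (F : (a + b).-tuple 'I_n -> R) :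
  \sum_t F t = \sum_(s : a.-tuple 'I_n) \sum_(u : b.-tuple 'I_n) F [tuple of s ++ u].
Proof.
under eq_bigr do rewrite -seqfunE.
rewrite (@sum_tupleD _ _ _ _ (seqfun F)).
by do 2!(apply: eq_bigr => ? _); rewrite -seqfunE.
Qed.

Lemma quadform_tens d e (A : 'M[R]_(tdim n d)) (v : 'rV[R]_(tdim n (d + e))) :
  (v *m tens A (tpow 1%:M e) *m v^T) 0 0 = qform d e (tensorfun A) (vecfun v).
Proof.
have tpow1 (t u : e.-tuple 'I_n) : tentry (tpow 1%:M e) t u = (t == u)%:R :> R.
  rewrite tentry_tmx; under eq_bigr do rewrite mxE.
  rewrite -natr_prod; congr _%:R; have [->|ne] := eqVneq t u.
    by apply: big1 => i _; rewrite eqxx.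
  have /forallPn[i hi] : ~~ [forall i, tnth t i == tnth u i].
    by apply: contra ne => /forallP h; apply/eqP/eq_from_tnth => i; apply/eqP.
  by rewrite (bigD1 i) //= (negPf hi) mul0n.
rewrite mxE sum_tdim sum_tuple_cat /qform exchange_big [RHS]exchange_big /=.
under [RHS]eq_bigr do under eq_bigr do rewrite mulr_sumr.
under [RHS]eq_bigr do rewrite exchange_big.
rewrite exchange_big /=; apply: eq_bigr => c _; apply: eq_bigr => b _.
rewrite mxE sum_tdim sum_tuple_cat mulr_suml; apply: eq_bigr => a _.
under eq_bigr => b' _.
  rewrite -[tens _ _ _ _]/(tentry (tens A (tpow 1%:M e)) _ _) tentry_tmx tpow1.
  rewrite !tleft_cat !tright_cat mulrA mulrC eq_sym.
  over.
rewrite sum_tuple_eq mxE tensorfunE /vecfun.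
rewrite -[a ++ b]/(tval [tuple of a ++ b]) -[c ++ b]/(tval [tuple of c ++ b]).
by rewrite !seqfunE; ring.
Qed.
End Tensors.

(** * Orthogonal projections *)
Section OrthogonalProjection.
Variables (R : realType) (m N : nat) (U : 'M[R]_(m, N)).

Lemma row_sqr_eq0 (x : 'rV[R]_N) : x *m x^T = 0 -> x = 0.
Proof.
move/matrixP => /(_ 0 0); rewrite !mxE => h; apply/rowP => i; rewrite mxE.
have h0 j : true -> 0 <= x 0 j * x^T j 0 by rewrite mxE -expr2 sqr_ge0.
have /(_ i isT)/eqP := psumr_eq0P (fun j => h0 j) h.
by rewrite mxE mulf_eq0 orbb => /eqP.
Qed.

Lemma cap_orthogonal : (<<U>> :&: kermx U^T = 0)%MS.
Proof.
apply/eqP; rewrite -submx0; apply/rV_subP => x.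
rewrite sub_capmx genmxE => /andP[/submxP[y ey] /sub_kermxP xk].
by rewrite (@row_sqr_eq0 x) ?sub0mx // {2}ey trmx_mul mulmxA xk mul0mx.
Qed.

Lemma sum_orthogonal : (1%:M <= <<U>> + kermx U^T)%MS.
Proof.
rewrite sub1mx /row_full; have := mxrank_sum_cap <<U>>%MS (kermx U^T).
rewrite cap_orthogonal mxrank0 addn0 => ->.
by rewrite mxrank_gen mxrank_ker mxrank_tr subnKC ?rank_leq_col.
Qed.

Lemma orthoproj_sub k (w : 'M_(k, N)) : (w *m orthoproj U <= U)%MS.
Proof. by rewrite -(genmxE U) proj_mx_sub. Qed.

Lemma orthoproj_id k (w : 'M_(k, N)) : (w <= U)%MS -> w *m orthoproj U = w.
Proof. by move=> h; rewrite proj_mx_id ?cap_orthogonal ?genmxE. Qed.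

(** The rows of 1 - P are orthogonal to those of P, so P = P P^T. *)
Lemma orthoproj_tr : (orthoproj U)^T = orthoproj U.
Proof.
set P := orthoproj U.
have /submxP[X eX] : (P <= U)%MS by rewrite -[P]mul1mx orthoproj_sub.
have /sub_kermxP hk : (1%:M - P <= kermx U^T)%MS.
  by rewrite -[X in _ - X]mul1mx proj_mx_compl_sub ?sum_orthogonal.
have h : P *m (1%:M - P)^T = 0.
  by rewrite {1}eX -mulmxA -[U]trmxK -trmx_mul hk trmx0 mulmx0.
have e : P = P *m P^T.
  by apply/eqP; rewrite -subr_eq0 -{1}[P]mulmx1 -mulmxBr -trmx1 -linearB h.
by rewrite e trmx_mul trmxK.
Qed.
End OrthogonalProjection.

(** * The maximally symmetric matrix and its lift *)
Section MaxSymTensor.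
Variables (R : realType) (n d : nat).

Lemma tensorfun_tuple (F : seq 'I_n -> R) (t : (2 * d).-tuple 'I_n) :
  tensorfun (tmx (fun a c : d.-tuple 'I_n => F (a ++ c))) t = F t.
Proof.
have ht : size t == (d + d)%N by rewrite size_tuple mul2n addnn.
rewrite /tensorfun -[tval t]/(tval (Tuple ht)) seqfunE tentry_tmx.
by rewrite cat_tleft_tright.
Qed.

Lemma MaxSymP (f : {mpoly R[n]}) : f \is (2 * d)%N.-homog -> is_MaxSym f (MaxSym d f).
Proof.
move=> hf; have [F [hF eF]] := form_exists hf.
apply: xgetPex; exists (tmx (fun a c : d.-tuple 'I_n => F (a ++ c))); split.
  move=> s t; rewrite !tentry_tmx !cat_tleft_tright; apply: hF.
  by apply/tuple_permP; exists s.
move=> x; rewrite meval_form_tensorfun /peval -eF !meval_form.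
by apply: eq_bigr => t _; rewrite tensorfun_tuple.
Qed.

Lemma meval_form_MaxSym (f : {mpoly R[n]}) y : f \is (2 * d)%N.-homog ->
  (form (2 * d) (tensorfun (MaxSym d f))).@[y] = f.@[y].
Proof.
move=> /MaxSymP[_ /(_ (\col_i y i))]; rewrite meval_form_tensorfun /peval => e.
transitivity (f.@[fun i => (\col_i0 y i0) i 0]).
  by rewrite e; apply: meval_eq => i; rewrite mxE.
by apply: meval_eq => i; rewrite mxE.
Qed.

Lemma MaxSym_sym (f : {mpoly R[n]}) : f \is (2 * d)%N.-homog ->
  symmetric_fun (tensorfun (MaxSym d f)).
Proof. by case/MaxSymP => /tensorfun_sym. Qed.

Lemma MaxSym_tr (f : {mpoly R[n]}) : f \is (2 * d)%N.-homog ->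
  (MaxSym d f)^T = MaxSym d f.
Proof.
move=> hf; apply/matrixP => j k; rewrite mxE.
have := MaxSym_sym hf; set A := MaxSym d f => hA.
rewrite -[j]enum_valK -[k]enum_valK -!/(tentry A _ _) -!tensorfunE.
by apply: hA; rewrite perm_catC.
Qed.

Lemma sqnorm_homog : (sqnorm R n) ^+ d \is (2 * d)%N.-homog.
Proof.
apply: dhomogMn; rewrite /sqnorm; apply: rpred_sum => i _.
by rewrite mpolyXn dhomogX /= mdegMn mdeg1.
Qed.
End MaxSymTensor.

Section Symlift.
Variables (R : realType) (n d r : nat).
Let r' := (d + (r - d))%N.

Lemma symlift_tr (A : 'M[R]_(tdim n d)) : A^T = A -> (symlift r A)^T = symlift r A.
Proof.
move=> hA; rewrite /symlift /symproj trmx_mul [(_ *m tens _ _)^T]trmx_mul !orthoproj_tr -mulmxA; congr (_ *m (_ *m _)).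
apply/matrixP => i j; rewrite !mxE !tentry_tmx; congr (_ * _).
  by rewrite /tentry -{1}hA mxE.
by apply: eq_bigr => k _; rewrite !mxE eq_sym.
Qed.

Lemma symlift_quad (A : 'M[R]_(tdim n d)) (w : 'rV[R]_(tdim n r')) :
  (w *m symlift r A *m w^T) 0 0 =
  qform d (r - d) (tensorfun A) (vecfun (w *m symproj R n r')).
Proof.
by rewrite -quadform_tens trmx_mul /symlift /symproj orthoproj_tr !mulmxA.
Qed.

Lemma symproj_sym (w : 'rV[R]_(tdim n r')) :
  symmetric_fun (vecfun (w *m symproj R n r')).
Proof. by apply: vecfun_sym; exact: orthoproj_sub. Qed.
End Symlift.

(** * Values on the unit sphere *)
Section Sphere.
Variables (R : realType) (n : nat).
Implicit Types (p : {mpoly R[n]}) (y : 'I_n -> R) (x : 'cV[R]_n).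

Lemma usphereE x : usphere R n x <-> \sum_i x i 0 ^+ 2 = 1.
Proof.
have h0 : 0 <= \sum_i x i 0 ^+ 2 by apply: sumr_ge0 => i _; exact: sqr_ge0.
rewrite /usphere /=; split=> [h|->]; last exact: sqrtr1.
by rewrite -(sqr_sqrtr h0) h expr1n.
Qed.

Lemma sphere_bounded p : exists B : R, forall x, usphere R n x -> `|peval p x| <= B.
Proof.
exists (\sum_(m <- msupp p) `|p@_m|) => x /usphereE hx.
rewrite /peval mevalE; apply: le_trans (ler_norm_sum _ _ _) _.
apply: ler_sum => m _; rewrite normrM -[leRHS]mulr1; apply: ler_wpM2l => //.
rewrite normr_prod; apply: prodr_ile1 => i _; rewrite normrX exprn_ge0 //=.
apply: exprn_ile1 => //; rewrite -(@expr_le1 _ 2) // real_normK ?num_real //.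
by rewrite -hx (bigD1 i) //= lerDl; apply: sumr_ge0 => j _; exact: sqr_ge0.
Qed.

Lemma pmin_le p x : usphere R n x -> pmin p <= peval p x.
Proof.
move=> hx; have [B hB] := sphere_bounded p.
apply: ge_inf; last by exists x.
by exists (- B) => _ [z hz <-]; have := hB z hz; rewrite ler_norml => /andP[].
Qed.

Lemma pmax_ge p x : usphere R n x -> peval p x <= pmax p.
Proof.
move=> hx; have [B hB] := sphere_bounded p.
apply: ub_le_sup; last by exists x.
by exists B => _ [z hz <-]; have := hB z hz; rewrite ler_norml => /andP[].
Qed.

Lemma usphere_nonempty : (1 <= n)%N -> exists x, usphere R n x.
Proof.
move=> hn; pose i0 : 'I_n := Ordinal hn; exists (\col_i (i == i0)%:R).
apply/usphereE; rewrite (bigD1 i0) //= mxE eqxx expr1n big1 ?addr0 // => i ne.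
by rewrite mxE (negPf ne) expr0n.
Qed.

Lemma meval_homog_scale m p (c : R) y : p \is m.-homog ->
  p.@[fun i => c * y i] = c ^+ m * p.@[y].
Proof.
move/dhomogP => hp; rewrite !mevalE mulr_sumr; apply: eq_big_seq => mm hm.
under eq_bigr do rewrite exprMn.
rewrite big_split /= prodrXr -mdegE -[mdeg mm]/(mdeg mm) (hp _ hm).
by rewrite mulrCA.
Qed.

(** The bounds on the sphere are extended by homogeneity; where y = 0 all three
    terms vanish because d is positive. *)
Lemma homog_sphere_bounds d p y : (1 <= d)%N -> p \is (2 * d)%N.-homog ->
  pmin p * (\sum_i y i ^+ 2) ^+ d <= p.@[y] <= pmax p * (\sum_i y i ^+ 2) ^+ d.
Proof.
move=> hd hp; set S := \sum_i _.
have S0 : 0 <= S by apply: sumr_ge0 => i _; exact: sqr_ge0.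
have [Sz|Snz] := eqVneq S 0.
  have -> : p.@[y] = p.@[fun i => 0 * y i].
    apply: meval_eq => i; rewrite mul0r.
    have /(_ i isT)/eqP := psumr_eq0P (fun j _ => sqr_ge0 (y j)) Sz.
    by rewrite sqrf_eq0 => /eqP.
  rewrite (meval_homog_scale _ _ hp) Sz !expr0n muln_eq0 /=.
  by case: d hd {hp} => // d _; rewrite !mulr0 mul0r lexx.
have Spos : 0 < S by rewrite lt_neqAle eq_sym Snz.
set t := Num.sqrt S; have tpos : 0 < t by rewrite sqrtr_gt0.
have t2 : t ^+ 2 = S by rewrite sqr_sqrtr.
pose x : 'cV[R]_n := \col_i (t^-1 * y i).
have hx : usphere R n x.
  apply/usphereE; under eq_bigr do rewrite mxE exprMn.
  by rewrite -mulr_sumr -/S exprVn t2 mulVf.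
have e : p.@[y] = peval p x * S ^+ d.
  rewrite -t2 -exprM mulrC /peval -(meval_homog_scale _ _ hp).
  by apply: meval_eq => i; rewrite mxE mulVKf // gt_eqF.
by rewrite e !ler_wpM2r ?exprn_ge0 ?pmin_le ?pmax_ge.
Qed.
End Sphere.

(** * The lifted form of the power of the squared norm *)
Section FormArithmetic.
Variables (R : realType) (n : nat).
Implicit Types (A B v : seq 'I_n -> R).

Lemma qform_lin d e A B v (a b : R) :
  qform d e (fun s => a * A s + b * B s) v = a * qform d e A v + b * qform d e B v.
Proof.
rewrite /qform !mulr_sumr -big_split; apply: eq_bigr => s _.
rewrite !mulr_sumr -big_split; apply: eq_bigr => t _ /=.
by rewrite mulrDl !mulrA.
Qed.

Lemma meval_form_lin m A B (a b : R) y :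
  (form m (fun s => a * A s + b * B s)).@[y] = a * (form m A).@[y] + b * (form m B).@[y].
Proof.
rewrite !meval_form !mulr_sumr -big_split; apply: eq_bigr => s _ /=.
by rewrite mulrDl !mulrA.
Qed.

(** The moment tensor divided by its factor has the same form as the tensor of
    s^d, so [form_inj] identifies the two and [qform_gtensor_ge] applies. *)
Lemma qform_sqnorm_ge d e v : symmetric_fun v ->
  d`!%:R / gmoment R (2 * d) * sqsum (d + e) v
    <= qform d e (tensorfun (MaxSym d ((sqnorm R n) ^+ d))) v.
Proof.
move=> hv; set M := tensorfun _; pose k := gmoment R (2 * d).
have k0 : 0 < k := gmoment_even_gt0 R d.
have hM (a c : d.-tuple 'I_n) : M (a ++ c) = k^-1 * gtensor R (a ++ c).
  have ht : size (a ++ c) == (2 * d)%N by rewrite size_cat !size_tuple addnn mul2n.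
  have hs : symmetric_fun (fun s : seq 'I_n => k^-1 * gtensor R s).
    by move=> s t st; rewrite (gtensor_sym R st).
  rewrite -[a ++ c]/(tval (Tuple ht)).
  apply: (form_inj (B := fun s => k^-1 * gtensor R s)) => //.
    exact/MaxSym_sym/sqnorm_homog.
  move=> y; rewrite meval_form_MaxSym ?sqnorm_homog // rmorphXn /= meval_sqnorm.
  transitivity (k^-1 * (form (2 * d) (@gtensor R n)).@[y]).
    by rewrite meval_form_gtensor mulKf // gt_eqF.
  by rewrite !meval_form mulr_sumr; apply: eq_bigr => t _; rewrite mulrA.
have -> : qform d e M v = k^-1 * qform d e (@gtensor R n) v.
  rewrite /qform mulr_sumr; apply: eq_bigr => a _; rewrite mulr_sumr.
  by apply: eq_bigr => c _; rewrite hM mulrA.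
rewrite [_ / _]mulrC -mulrA; apply: ler_wpM2l; first by rewrite invr_ge0 ltW.
exact: qform_gtensor_ge.
Qed.
End FormArithmetic.

(** * The rate of convergence *)
Theorem theorem5p7 (R : realType) (n d : nat) (hn : (1 <= n)%N) (hd : (1 <= d)%N) :
  exists (c : R) (r0 : nat),
    [/\ 0 < c, (d <= r0)%N &
      forall p : {mpoly R[n]}, p \is (2 * d)%N.-homog ->
      forall r : nat, (r0 <= r)%N ->
        pmin p - sp d r p <= (pmax p - pmin p) * (c / r%:R)].
Proof.
pose k0 : R := d`!%:R / gmoment R (2 * d).
have k0pos : 0 < k0 by rewrite divr_gt0 ?gmoment_even_gt0 // ltr0n fact_gt0.
pose rho : R := remainder_const R n d.
have rho0 : 0 <= rho := remainder_const_ge0 R n d.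
have cpos : 0 < 2%:R * (rho + 1) / k0 by apply: divr_gt0 => //; lra.
exists (2%:R * (rho + 1) / k0), (2 * d)%N; split=> //.
- by rewrite leq_pmull.
move=> p hp r hr; set c := _ / k0 in cpos *.
pose e := (r - d)%N; pose sq := (sqnorm R n) ^+ d.
have sqh : sq \is (2 * d)%N.-homog := sqnorm_homog R n d.
pose Qt := tensorfun (MaxSym d p); pose Mt := tensorfun (MaxSym d sq).
set K := pmax p - pmin p.
have K0 : 0 <= K.
  have [x hx] := usphere_nonempty R hn.
  by rewrite subr_ge0 (le_trans (pmin_le p hx)) ?pmax_ge.
pose nu := pmin p - K * (c / r%:R).
have quad (mu : R) (w : 'rV[R]_(tdim n (d + (r - d)))) :
    (w *m (Qr d r p - mu *: Mr R n d r) *m w^T) 0 0 =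
    qform d e Qt (vecfun (w *m symproj R n (d + e)))
      - mu * qform d e Mt (vecfun (w *m symproj R n (d + e))).
  rewrite mulmxBr mulmxBl -scalemxAr -scalemxAl mxE [X in _ + X]mxE [X in _ - X]mxE.
  by rewrite !symlift_quad.
(* The claimed lower bound nu for the spectral bound is feasible: the form of
   Q - nu M is that of p - p_min s^d plus K c / r times that of s^d. *)
have psd : psdmx (Qr d r p - nu *: Mr R n d r).
  split.
    by rewrite linearB linearZ /= !symlift_tr ?MaxSym_tr.
  move=> w; rewrite quad; set v := vecfun _.
  have hv : symmetric_fun v := @symproj_sym R n d r w.
  have hQ : qform d e Qt v - nu * qform d e Mt v =
      qform d e (fun s => 1 * Qt s + (- pmin p) * Mt s) v
        + K * (c / r%:R) * qform d e Mt v.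
    by rewrite qform_lin /nu; ring.
  rewrite hQ.
  have hA : symmetric_fun (fun s => 1 * Qt s + (- pmin p) * Mt s).
    by move=> s t st; rewrite /Qt /Mt (MaxSym_sym hp st) (MaxSym_sym sqh st).
  have /(qform_ge e hA hv) h1 : forall y,
      0 <= (form (2 * d) (fun s => 1 * Qt s + (- pmin p) * Mt s)).@[y]
        <= K * (\sum_i y i ^+ 2) ^+ d.
    move=> y; rewrite meval_form_lin !meval_form_MaxSym // rmorphXn /= meval_sqnorm.
    have /andP[b1 b2] := homog_sphere_bounds y hd hp.
    by rewrite /K; apply/andP; split; lra.
  have h2 := qform_sqnorm_ge d e hv; rewrite -/k0 -/sq -/Mt in h2.
  set N := sqsum _ v in h1 h2.
  have N0 : 0 <= N := sqsum_ge0 _ v.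
  have rpos : 0 < r%:R :> R by rewrite ltr0n; lia.
  (* Here r0 = 2d enters: r <= 2 (r - d + 1) turns the rate 1 / (r - d + 1)
     of [qform_ge] into 2 / r. *)
  have e1 : r%:R <= 2%:R * e.+1%:R :> R by rewrite -natrM ler_nat /e; lia.
  have h3 : K * rho * N / e.+1%:R <= K * (c / r%:R) * qform d e Mt v.
    apply: (@le_trans _ _ (K * (c / r%:R) * (k0 * N))); last first.
      apply: ler_wpM2l h2; by rewrite mulr_ge0 // divr_ge0 // ltW.
    have -> : K * (c / r%:R) * (k0 * N) = (K * N) * (2%:R * (rho + 1) / r%:R).
      by rewrite /c; field; rewrite ?gt_eqF.
    have -> : K * rho * N / e.+1%:R = (K * N) * (rho / e.+1%:R) by ring.
    apply: ler_wpM2l; first exact: mulr_ge0.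
    rewrite ler_pdivrMr ?ltr0n // mulrAC ler_pdivlMr //.
    nra.
  move: h1; rewrite mulNr -/rho => h1.
  by rewrite -(addNr (K * rho * N / e.+1%:R)) lerD.
(* Any w whose projection to the symmetric tensors is nonzero bounds the set
   by a Rayleigh quotient; the tensor with all entries 1 is one. *)
have ubd : has_ubound [set mu : R | psdmx (Qr d r p - mu *: Mr R n d r)].
  pose w : 'rV[R]_(tdim n (d + (r - d))) := const_mx 1.
  pose v := vecfun (w *m symproj R n (d + e)).
  have hv : symmetric_fun v := @symproj_sym R n d r w.
  have Mpos : 0 < qform d e Mt v.
    apply: lt_le_trans (qform_sqnorm_ge d e hv).
    rewrite mulr_gt0 // /sqsum.
    have ew : w *m symproj R n (d + e) = w.
      by apply: orthoproj_id; apply/symTP => s t; rewrite !mxE.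
    pose t0 : (d + e).-tuple 'I_n := [tuple (Ordinal hn) | i < d + e].
    have vt0 : v t0 = 1 by rewrite /v ew; apply: etrans (seqfunE _ t0) _; rewrite mxE.
    rewrite (bigD1 t0) //= vt0 expr1n ltr_wpDr //.
    by apply: sumr_ge0 => t _; exact: sqr_ge0.
  exists (qform d e Qt v / qform d e Mt v) => mu [_ /(_ w)]; rewrite quad -/v => h.
  by rewrite ler_pdivlMr // -subr_ge0.
have : nu <= sp d r p by apply: ub_le_sup.
by rewrite /nu; lra.
Qed.
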